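(* For nonnegative integer matrices $M$, the ratio $\dfrac{\operatorname{rank}^+(M)}{\operatorname{rank}^+_{\mathbb{Z}}(M)}$ can be arbitrarily close to zero, even if we restrict to $\operatorname{rank}^+(M)=2$. That is, for every $\varepsilon>0$ there exists a nonnegative integer matrix $M$ with $\operatorname{rank}^+(M)=2$ and $\operatorname{rank}^+(M)/\operatorname{rank}^+_{\mathbb{Z}}(M)<\varepsilon$.
   Context: For a matrix $A$ with nonnegative integer entries of size $n\times m$: the nonnegative rank $\operatorname{rank}^+(A)$ is the smallest $k$ such that $A=BC$ with $B\in\mathbb{R}_+^{n\times k}$ and $C\in\mathbb{R}_+^{k\times m}$; the nonnegative integer rank $\operatorname{rank}^+_{\mathbb{Z}}(A)$ is the smallest $k$ such that $A=BC$ with $B\in\mathbb{Z}_+^{n\times k}$ and $C\in\mathbb{Z}_+^{k\times m}$. Here $\mathbb{R}_+$ and $\mathbb{Z}_+$ denote nonnegative reals and nonnegative integers. *)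

(* Defs.v *)
From mathcomp Require Import all_boot all_order all_algebra.
From mathcomp Require Import boolp reals.

Set Implicit Arguments.
Unset Strict Implicit.
Unset Printing Implicit Defensive.

Import Order.TTheory GRing.Theory Num.Theory.

Local Open Scope ring_scope.

(* Nonnegative integer matrices are matrices over the semiring nat, so [*m] in
   [nnint_factorization] is the matrix product over nat. *)

Definition nn_factorization (R : realType) (n m : nat) (A : 'M[nat]_(n, m))
    (k : nat) : Prop :=
  exists (B : 'M[R]_(n, k)) (C : 'M[R]_(k, m)),
    [/\ forall i j, 0 <= B i j, forall i j, 0 <= C i j &
        map_mx (fun a : nat => a%:R : R) A = B *m C].

Definition nnint_factorization (n m : nat) (A : 'M[nat]_(n, m))
    (k : nat) : Prop :=
  exists (B : 'M[nat]_(n, k)) (C : 'M[nat]_(k, m)), A = B *m C.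

Lemma nn_factorization_exists (R : realType) (n m : nat) (A : 'M[nat]_(n, m)) :
  exists k, `[< nn_factorization R A k >].
Proof.
exists n; apply/asboolP; exists 1%:M, (map_mx (fun a : nat => a%:R) A).
split=> [i j|i j|]; rewrite ?mxE ?ler0n //.
by rewrite mul1mx.
Qed.

Lemma nnint_factorization_exists (n m : nat) (A : 'M[nat]_(n, m)) :
  exists k, `[< nnint_factorization A k >].
Proof. by exists n; apply/asboolP; exists 1%:M, A; rewrite mul1mx. Qed.

(* The minimum exists: the trivial factorization A = 1 A has k = n. *)
Definition nnrank (R : realType) (n m : nat) (A : 'M[nat]_(n, m)) : nat :=
  ex_minn (nn_factorization_exists R A).

Definition nnintrank (n m : nat) (A : 'M[nat]_(n, m)) : nat :=
  ex_minn (nnint_factorization_exists A).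

(* Main.v *)
Require Import Defs.
From mathcomp Require Import all_boot all_order all_algebra.
From mathcomp Require Import boolp reals.
From mathcomp Require Import zify ring lra.

Import Order.TTheory GRing.Theory Num.Theory.

Local Open Scope ring_scope.

(** Write [(2 + sqrt 3)^n = c_n + d_n sqrt 3] and take [M i j = c_|i-j|].
    Since [2 c_|i-j| = l^i u^j + u^i l^j] with [l, u = 2 +- sqrt 3] and
    [l u = 1], the matrix [M] has nonnegative rank 2.  Its diagonal entries
    are 1 and all the others are at least 2.  In a factorization [M = B C] over
    nat of inner dimension [k], exactly one term [t_i] contributes to the
    diagonal entry [i].  If [i] and [j] have the same [t] and rows [i] and [j]
    of [B] the same support, then only the term [t] contributes to [M i j],
    which is thus 1, so [i = j]; hence the size of [M] is at most [k 2^k]. *)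

Fixpoint pell (n : nat) : nat * nat :=
  if n is n'.+1 then
    let: (c, d) := pell n' in (2 * c + 3 * d, c + 2 * d)%N
  else (1, 0)%N.

Lemma pell_fst_gt0 (n : nat) : (0 < (pell n).1)%N.
Proof. by elim: n => //= n; case: (pell n) => c d /= ?; lia. Qed.

Lemma pell_fst_gt1 (n : nat) : (0 < n)%N -> (1 < (pell n).1)%N.
Proof.
case: n => //= n _; have := pell_fst_gt0 n.
by case: (pell n) => c d /=; lia.
Qed.

(** Any square root [s] of 3 is allowed, so the formula serves for both [sqrt 3] and its negative;
    adding the two cancels the [d_n] parts and leaves [2 c_n]. *)
Lemma pell_expE (R : comPzRingType) (s : R) (n : nat) : s ^+ 2 = 3 ->
  (2 + s) ^+ n = (pell n).1%:R + (pell n).2%:R * s.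
Proof.
move=> s2; elim: n => [|n IHn]; first by rewrite expr0 mul0r addr0.
rewrite exprS IHn /=; case: (pell n) => c d /=.
have -> : (2 + s) * (c%:R + d%:R * s) =
  2 * c%:R + d%:R * s ^+ 2 + (c%:R + 2 * d%:R) * s by ring.
by rewrite s2 !natrD; ring.
Qed.

Lemma expr_inv_sub (R : comPzRingType) (l u : R) (i j : nat) :
  l * u = 1 -> (j <= i)%N -> l ^+ i * u ^+ j = l ^+ (i - j).
Proof.
move=> lu ji.
by rewrite -{1}(subnK ji) exprD -mulrA -exprMn lu expr1n mulr1.
Qed.

(* One of the truncated differences is 0, so their sum is |i - j|. *)
Definition pell_mx (n : nat) : 'M[nat]_n :=
  \matrix_(i, j) (pell ((i - j) + (j - i))%N).1.

Lemma pell_mx_diag (n : nat) (i : 'I_n) : pell_mx n i i = 1%N.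
Proof. by rewrite mxE subnn. Qed.

Lemma pell_mx_offdiag (n : nat) (i j : 'I_n) :
  i != j -> (1 < pell_mx n i j)%N.
Proof.
by rewrite -val_eqE => ij; rewrite mxE pell_fst_gt1 //; move: ij => /=; lia.
Qed.

Lemma pell_mx_nn_factorization (R : realType) (n : nat) :
  nn_factorization R (pell_mx n) 2.
Proof.
pose s : R := Num.sqrt 3.
have s2 : s ^+ 2 = 3 by rewrite sqr_sqrtr.
have s_ge0 : 0 <= s by rewrite sqrtr_ge0.
have u_ge0 : 0 <= 2 - s by nra.
have ul : (2 - s) * (2 + s) = 1 by rewrite -subr_sqr s2; ring.
have lu : (2 + s) * (2 - s) = 1 by rewrite mulrC.
have l_ge0 : 0 <= 2 + s by lra.
have sumE k : (2 + s) ^+ k + (2 - s) ^+ k = 2 * (pell k).1%:R.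
  rewrite (pell_expE _ _ _ s2) (pell_expE _ (- s)) ?sqrrN //; ring.
(* One inner index for each term of [l^i u^j + u^i l^j = 2 c_|i-j|], where [l = 2 + s] and
   [u = 2 - s]; the right factor absorbs the 2. *)
exists (\matrix_(i, t) if t == ord0 then (2 + s) ^+ i else (2 - s) ^+ i).
exists (\matrix_(t, j) ((if t == ord0 then (2 - s) ^+ j else (2 + s) ^+ j) / 2)).
split=> [i t|t j|]; rewrite ?mxE.
- by case: ifP; rewrite exprn_ge0.
- by case: ifP; rewrite divr_ge0 // exprn_ge0.
apply/matrixP => i j; rewrite !mxE !big_ord_recl big_ord0 !mxE /= addr0.
rewrite !mulrA -mulrDl; have two_neq0 : (2 : R) != 0 by rewrite pnatr_eq0.
apply: (mulfI two_neq0); rewrite -sumE [2 * (_ / _)]mulrC divfK //.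
case: (leqP j i) => [ji|/ltnW ij].
  by rewrite !expr_inv_sub // (eqP (_ : j - i == 0)%N) ?subn_eq0 // addn0.
rewrite ![_ ^+ i * _]mulrC !expr_inv_sub // (eqP (_ : i - j == 0)%N) ?subn_eq0 //.
by rewrite add0n addrC.
Qed.

(** Inner dimension at most 1 means rank at most 1, so all 2 x 2 minors vanish; they are written
    without subtraction because the entries lie in [nat]. *)
Lemma nn_factorization_le1 (R : realType) (n m k : nat) (A : 'M[nat]_(n, m)) :
  nn_factorization R A k -> (k <= 1)%N ->
  forall i i' j j', (A i j * A i' j' = A i j' * A i' j)%N.
Proof.
move=> [B [C [_ _ AE]]] k1 i i' j j'.
have AijE a b : (A a b)%:R = \sum_t B a t * C t b.
  by have /matrixP/(_ a b) := AE; rewrite !mxE.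
apply/eqP; rewrite -(eqr_nat R) !natrM !AijE.
case: k k1 B C {AE AijE} => [|[|//]] _ B C; first by rewrite !big_ord0 !mul0r.
by rewrite !big_ord1; apply/eqP; ring.
Qed.

Lemma nnrank_pell_mx (R : realType) (n : nat) : nnrank R (pell_mx n.+2) = 2%N.
Proof.
rewrite /nnrank; case: ex_minnP => k /asboolP kP kmin.
apply/eqP; rewrite eqn_leq kmin /=; last first.
  exact/asboolP/pell_mx_nn_factorization.
case: (ltnP 1 k) => // k1.
(* In the minor on the first and last indices the diagonal product is 1, which would force
   off-diagonal entries equal to 1. Size at least 2 keeps the two indices distinct. *)
have := nn_factorization_le1 _ _ _ _ _ kP k1 ord0 ord_max ord0 ord_max.
rewrite !pell_mx_diag => /esym/eqP; rewrite muln_eq1 => /andP[/eqP h _].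
by have := @pell_mx_offdiag n.+2 ord0 ord_max isT; rewrite h.
Qed.

Lemma nnint_factorization_card (n k : nat) (A : 'M[nat]_n) :
  (forall i, A i i = 1%N) -> (forall i j, i != j -> A i j != 1%N) ->
  nnint_factorization A k -> (n <= k * 2 ^ k)%N.
Proof.
move=> Adiag Aoff [B [C AE]].
have AijE i j : A i j = (\sum_t B i t * C t j)%N by rewrite AE mxE.
have termP i : exists t,
    (B i t * C t i == 1)%N && [forall s, (s != t) ==> (B i s * C s i == 0)%N].
  have /eqP := Adiag i; rewrite AijE => /sum_nat_eq1[t [_ BC1 BC0]].
  exists t; rewrite BC1; apply/forallP => s.
  by apply/implyP => /BC0 ->.
pose f i := xchoose (termP i).
have fP i := xchooseP (termP i).
pose lab i := (f i, [set s | B i s != 0%N]).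
have lab_inj : injective lab.
  move=> i j [fij Sij]; apply/eqP/negP => /negP/Aoff/eqP[].
  have /andP[/eqP/eqP + _] := fP i; rewrite muln_eq1 => /andP[/eqP Bi _].
  have /andP[+ /forallP Cj] := fP j; rewrite muln_eq1 => /andP[_ /eqP Ctj].
  (* For any other [s], either [C s j = 0] or [B j s = 0]; in the latter case the equal supports
     give [B i s = 0]. Only the common term [1 * 1] survives. *)
  rewrite AijE (bigD1 (f i)) //= Bi fij Ctj big1 // => s /negPf sf.
  have := Cj s; rewrite sf /= muln_eq0 => /orP[/eqP Bjs|/eqP->]; last exact: muln0.
  move/setP/(_ s): Sij; rewrite !inE Bjs eqxx => /negbFE/eqP->.
  exact: mul0n.
have := leq_card lab lab_inj.
by rewrite card_prod -[X in (_ * X)%N]cardsT -powersetT card_powerset cardsT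
  !card_ord.
Qed.

Theorem corollary5p7 (R : realType) (eps : R) (heps : 0 < eps) :
  exists (n m : nat) (M : 'M[nat]_(n, m)),
    nnrank R M = 2%N /\ (nnrank R M)%:R / (nnintrank M)%:R < eps.
Proof.
(* Every [k > K] gives [2 / k < eps]. Since [k * 2 ^ k] increases with [k], a size above [K * 2 ^ K]
   rules out [k <= K]; adding 2 also ensures nonnegative rank 2. *)
pose K := Num.bound (2 / eps).
have KP : 2 / eps < K%:R by apply: archi_boundP; rewrite divr_ge0 // ltW.
exists (K * 2 ^ K).+2, (K * 2 ^ K).+2, (pell_mx (K * 2 ^ K).+2).
rewrite nnrank_pell_mx; split=> //.
rewrite /nnintrank; case: ex_minnP => k /asboolP kP _.
have Ak := nnint_factorization_card _ _ _ (@pell_mx_diag _) _ kP.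
have {Ak} : ((K * 2 ^ K).+2 <= k * 2 ^ k)%N.
  by apply: Ak => i j /pell_mx_offdiag; case: eqP => // ->.
case: (leqP k K) => [kK|Kk _].
  by move/(leq_trans)/(_ (leq_mul kK (leq_pexp2l (isT : 0 < 2)%N kK))); lia.
have k_gt0 : (0 : R) < k%:R by rewrite ltr0n (leq_ltn_trans _ Kk).
rewrite ltr_pdivrMr // mulrC -ltr_pdivrMr //.
by apply: lt_trans KP _; rewrite ltr_nat.
Qed.
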